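(* Suppose $M\in\{\mathbb N,\mathbb Z\}$ and let $X$ be a sofically presented dynamical $M$-system. Then the topological dimension of $X$ is finite.
   Context: A dynamical $M$-system is an action of $M$ by continuous maps on a compact metrizable space (for $M=\mathbb N$ a continuous self-map, for $M=\mathbb Z$ a homeomorphism). Two systems are conjugate ($\cong$) if there is an equivariant homeomorphism between them. A subshift over $M$ is a closed shift-invariant subset of $\Sigma^M$, $\Sigma$ a finite alphabet; it is an SFT if it is defined by a finite set of forbidden words, and sofic if it is the image of an SFT under a continuous shift-commuting map. $(\Sigma^2)^M$ is identified with $\Sigma^M\times\Sigma^M$. A system $X$ is sofically presented (sofic/sofic) if $X\cong Y/Z$ for some sofic shifts $Y\subset\Sigma^M$, $Z\subset(\Sigma^2)^M$ such that $Z\cap Y^2$ is an equivalence relation on $Y$, where $Y/Z$ is the topological quotient $Y/(Z\cap Y^2)$ with the induced shift action $m[y]=[my]$. Topological dimension is Lebesgue covering dimension. *)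

(* Defs.v *)
From HB Require Import structures.
From mathcomp Require Import all_boot all_algebra generic_quotient.
From mathcomp Require Import all_classical all_reals all_analysis.

Set Implicit Arguments.
Unset Strict Implicit.
Unset Printing Implicit Defensive.

Import GRing.Theory.

Local Open Scope classical_set_scope.
Local Open Scope card_scope.
Local Open Scope ring_scope.
Local Open Scope quotient_scope.

Definition homeomorphism (S T : topologicalType) (f : S -> T) : Prop :=
  continuous f /\ exists g : T -> S, [/\ continuous g, cancel f g & cancel g f].

Definition metrizable (R : realType) (T : topologicalType) : Prop :=
  exists (W : metricType R) (f : T -> W), homeomorphism f.

Definition open_cover (T : topologicalType) (C : set (set T)) : Prop :=
  (forall U, C U -> open U) /\ \bigcup_(U in C) U = setT.

Definition refines (T : Type) (D C : set (set T)) : Prop :=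
  forall V, D V -> exists2 U, C U & V `<=` U.

Definition covering_dim_le (T : topologicalType) (n : nat) : Prop :=
  forall C : set (set T), open_cover C ->
  exists D : set (set T), [/\ open_cover D, refines D C &
    forall x : T, [set V | D V /\ V x] #<= `I_n.+1].

Definition finite_covering_dim (T : topologicalType) : Prop :=
  exists n : nat, covering_dim_le T n.

(* Only the additive monoid of M acts; the ring structure of M (here nat or
   int) serves to embed the word positions i : nat as i%:R in M. *)
Record mspace (M : nzSemiRingType) := MSpace {
  mspace_sort :> topologicalType;
  act : M -> mspace_sort -> mspace_sort;
  act0 : forall x, act 0 x = x;
  actD : forall m n x, act (m + n) x = act m (act n x);
  act_continuous : forall m, continuous (act m) }.

Definition dynamical_system (R : realType) (M : nzSemiRingType)
    (X : mspace M) : Prop :=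
  compact [set: X] /\ metrizable R X.

Definition equivariant (M : nzSemiRingType) (X Y : mspace M) (f : X -> Y) :=
  forall m x, f (act m x) = act m (f x).

Definition conjugate (M : nzSemiRingType) (X Y : mspace M) : Prop :=
  exists2 f : X -> Y, homeomorphism f & equivariant f.

Lemma ptws_continuous (I : Type) (K T : topologicalType)
    (f : T -> {ptws I -> K}) :
  (forall i, continuous (fun x => f x i)) -> continuous f.
Proof.
move=> cf x; apply/cvg_sup => i U [_ [[W oW <-]] /= Wx WU].
have fW : nbhs x [set y | W (f y i)] by apply: cf; exact: open_nbhs_nbhs.
by apply: filterS fW => y; exact: WU.
Qed.

Section Shifts.
Variables (M : nzSemiRingType) (Sigma : finType).

Definition config : topologicalType :=
  {ptws M -> discrete_topology Sigma}.

Definition shift (m : M) (x : config) : config := fun k => x (k + m).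

Lemma shift0 x : shift 0 x = x.
Proof. by apply: funext => k; rewrite /shift addr0. Qed.

Lemma shiftD m n x : shift (m + n) x = shift m (shift n x).
Proof. by apply: funext => k; rewrite /shift addrA. Qed.

Lemma shift_continuous m : continuous (shift m).
Proof.
apply: ptws_continuous => k.
exact: (@proj_continuous M (fun=> discrete_topology Sigma) (k + m)).
Qed.

Definition full_shift : mspace M := MSpace shift0 shiftD shift_continuous.

Record subshift := Subshift {
  subshift_set :> set config;
  subshift_closed : closed subshift_set;
  subshift_invariant : forall m x, subshift_set x -> subshift_set (shift m x) }.

Lemma subshift_act_subproof (Y : subshift) m (y : Y) :
  shift m (val y) \in (Y : set config).
Proof. by apply/mem_set/subshift_invariant/set_mem/valP. Qed.

Definition subshift_act (Y : subshift) (m : M) (y : Y) : Y :=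
  exist _ (shift m (val y)) (subshift_act_subproof m y).

Lemma subshift_act0 (Y : subshift) (y : Y) : subshift_act 0 y = y.
Proof. by apply: val_inj; rewrite /= shift0. Qed.

Lemma subshift_actD (Y : subshift) m n (y : Y) :
  subshift_act (m + n) y = subshift_act m (subshift_act n y).
Proof. by apply: val_inj; rewrite /= shiftD. Qed.

Lemma subshift_act_continuous (Y : subshift) m : continuous (@subshift_act Y m).
Proof.
apply: (@continuous_comp_initial Y Y config set_val) => y.
apply: (@continuous_comp _ _ _ set_val (shift m)).
  exact: initial_continuous.
exact: shift_continuous.
Qed.

Definition subshift_mspace (Y : subshift) : mspace M :=
  MSpace (@subshift_act0 Y) (@subshift_actD Y) (@subshift_act_continuous Y).

Definition occurs (w : seq Sigma) (x : config) : Prop :=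
  exists m : M, mkseq (fun i => x (m + i%:R)) (size w) = w.

Definition is_sft (Y : subshift) : Prop :=
  exists F : seq (seq Sigma),
    subshift_set Y = [set x | forall w, w \in F -> ~ occurs w x].

End Shifts.

Definition is_sofic (M : nzSemiRingType) (Sigma : finType)
    (Y : subshift M Sigma) : Prop :=
  exists (Gamma : finType) (X : subshift M Gamma)
    (f : subshift_mspace X -> full_shift M Sigma),
    [/\ is_sft X, continuous f, equivariant f & subshift_set Y = range f].

(* The identification of Sigma^M x Sigma^M with (Sigma^2)^M *)
Definition pair_config (M : nzSemiRingType) (Sigma : finType)
    (x y : config M Sigma) : config M (Sigma * Sigma)%type :=
  fun k => (x k, y k).

Section Quotient.
Variables (M : nzSemiRingType) (Sigma : finType).
Variables (Y : subshift M Sigma) (Z : subshift M (Sigma * Sigma)%type).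

(* The intersection of Z with Y^2, as a relation on Y *)
Definition pair_rel : rel Y :=
  fun y y' => `[< subshift_set Z (pair_config (val y) (val y')) >].

Definition is_equivalence : Prop :=
  [/\ reflexive pair_rel, symmetric pair_rel & transitive pair_rel].

Hypothesis ZY : is_equivalence.

Definition pair_equiv : equiv_rel Y :=
  @EquivRelPack Y pair_rel (let: And3 r s t := ZY in EquivClass r s t).

Definition quot_space : topologicalType :=
  quotient_topology {eq_quot pair_equiv}.

Definition quot_class (y : Y) : quot_space := \pi_{eq_quot pair_equiv} y.

Definition quot_act (m : M) (q : quot_space) : quot_space :=
  quot_class (subshift_act m (repr (q : {eq_quot pair_equiv}))).

Lemma quot_classP (y y' : Y) : quot_class y = quot_class y' <->
  subshift_set Z (pair_config (val y) (val y')).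
Proof.
rewrite -(asboolE (subshift_set Z _)) -/(pair_rel y y').
rewrite -[pair_rel y y']/(pair_equiv y y').
by split=> [/eqmodP//|?]; apply/eqmodP.
Qed.

Lemma quot_act_class m y :
  quot_act m (quot_class y) = quot_class (subshift_act m y).
Proof.
apply/quot_classP; rewrite /= -[pair_config _ _]/(shift m (pair_config _ _)).
by apply: subshift_invariant; apply/quot_classP; exact: reprK.
Qed.

Lemma quot_class_surj (q : quot_space) : exists y, q = quot_class y.
Proof. by exists (repr (q : {eq_quot pair_equiv})); rewrite /quot_class reprK. Qed.

Lemma quot_act0 q : quot_act 0 q = q.
Proof.
by have [y ->] := quot_class_surj q; rewrite quot_act_class subshift_act0.
Qed.

Lemma quot_actD m n q : quot_act (m + n) q = quot_act m (quot_act n q).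
Proof.
by have [y ->] := quot_class_surj q; rewrite !quot_act_class subshift_actD.
Qed.

Lemma quot_act_continuous m : continuous (quot_act m).
Proof.
apply/(@quotient_continuous _ {eq_quot pair_equiv}).
have -> : quot_act m \o \pi_(quotient_topology {eq_quot pair_equiv}) =
          quot_class \o subshift_act m.
  by apply: funext => y; exact: quot_act_class.
move=> y; apply: continuous_comp; first exact: subshift_act_continuous.
exact: (@pi_continuous _ {eq_quot pair_equiv}).
Qed.

Definition quot_mspace : mspace M :=
  MSpace quot_act0 quot_actD quot_act_continuous.

End Quotient.

Definition sofically_presented (M : nzSemiRingType) (X : mspace M) : Prop :=
  exists (Sigma : finType) (Y : subshift M Sigma)
    (Z : subshift M (Sigma * Sigma)%type) (ZY : is_equivalence Y Z),
    [/\ is_sofic Y, is_sofic Z & conjugate X (quot_mspace ZY)].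

(* Main.v *)
Require Import Defs.
From mathcomp Require Import all_boot all_algebra.
From mathcomp Require Import all_classical all_reals all_analysis.
From mathcomp Require Import generic_quotient zify.

(** Let [p : Y -> X] be the quotient map.  A finite window [I] of positions
    gives the open cover of [X] by the sets
      [fiber_nbhd p I y] = the fibres all of whose points agree on [I] with
                           some point of the fibre of [y].
    By compactness these covers refine any given open cover of [X] once [I] is
    large ([fiber_nbhd_refine]).  Let [x] be a point of [X] and [y0] a point
    above it.  If [fiber_nbhd p I y] contains [x], then the fibre of [y] has a
    point that agrees with [y0] on [I], and we may take [y] to be that point.
    So the order of the cover at [x] is at most the number of sets
    [fiber_nbhd p I y] where [y] carries one fixed word on [I].

    Soficness bounds this number independently of [I].  Write [Y] and [Z] as
    the images of subshifts of finite type under block codes [f2] and [f1].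
    The fibre of [y] consists of the points [f2 v] such that
    [f1 z = (y, f2 v)] for some [z].  A boundary layer [B] of [I], whose size
    is bounded independently of [I], separates [I] from its complement as far
    as the local rules can see.  Two solutions [(z, v)], for two points [y]
    that agree on [I], can be glued along [B] when the restrictions to [B] of
    [z], [v] and [f2 v] coincide.  Hence the words on [I] occurring in the
    fibre of [y] depend only on [y] restricted to [I] and on the set of patterns
    on [B] that solutions over [y] exhibit; the number of such sets is bounded
    ([sofic_fiber_finite_state]).  The monoid enters only through the existence
    of windows with boundary layers of bounded size
    ([nat_bounded_boundary], [int_bounded_boundary]). *)

Set Implicit Arguments.
Unset Strict Implicit.
Unset Printing Implicit Defensive.

Import GRing.Theory.

Local Open Scope classical_set_scope.
Local Open Scope card_scope.
Local Open Scope ring_scope.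
Local Open Scope quotient_scope.

(** * Compactness and finite windows *)

(** The configurations [x] and [y] carry the same word on the window [F]. *)
Definition agree (M : eqType) (S : Type) (F : seq M) (x y : M -> S) : Prop :=
  forall i, i \in F -> x i = y i.

Lemma agree_sym (M : eqType) (S : Type) (F : seq M) (x y : M -> S) :
  agree F x y -> agree F y x.
Proof. by move=> xy i iF; rewrite xy. Qed.

Lemma agree_trans (M : eqType) (S : Type) (F : seq M) (x y z : M -> S) :
  agree F x y -> agree F y z -> agree F x z.
Proof. by move=> xy yz i iF; rewrite xy// yz. Qed.

Lemma agree_sub (M : eqType) (S : Type) (F G : seq M) (x y : M -> S) :
  {subset F <= G} -> agree G x y -> agree F x y.
Proof. by move=> FG xy i /FG; exact: xy. Qed.

(** A property of points and windows that holds locally, for all large windows,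
    holds on a compact set for one window. *)
Lemma compact_window (T : topologicalType) (M : eqType) (K : set T)
    (P : seq M -> T -> Prop) :
  compact K ->
  (forall x, K x -> exists (F : seq M) (U : set T), nbhs x U /\
     forall (G : seq M) y, {subset F <= G} -> U y -> P G y) ->
  exists F, forall x, K x -> P F x.
Proof.
move=> /compact_near_coveringP cK locP.
pose Phi := filter_from setT (fun F : seq M => [set G : seq M | {subset F <= G}]).
have fPhi : Filter Phi.
  apply: filter_from_filter; first by exists [::].
  move=> F G _ _; exists (F ++ G) => // H FGH.
  by split=> i iF; apply: FGH; rewrite mem_cat iF ?orbT.
have [|F _ FP] := cK _ Phi P fPhi.
  move=> x Kx; have [F [U [xU FU]]] := locP x Kx.
  exists (U, [set G : seq M | {subset F <= G}]).
    by split=> //; exists F.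
  by move=> [y G] [Uy FG] /=; exact: FU.
by exists F => x Kx; exact: (FP F).
Qed.

Lemma compact_set_type (T : topologicalType) (A : set T) :
  compact A -> compact [set: A].
Proof.
move=> cA F PF _.
have FA : (set_val @ F) A.
  by apply: (@filterS _ F _ setT) filterT => a _; exact: (set_valP a).
have [a [Aa cla]] := cA _ (fmap_proper_filter set_val PF) FA.
exists (exist _ a (mem_set Aa)); split=> // C B FC [_ [[W oW <-] /= Wa] WB].
have FC' : (set_val @ F) (set_val @` C).
  by apply: (@filterS _ F _ C) FC => c Cc; exists c.
have [_ [[c Cc <-] Wc]] := cla _ _ FC' (open_nbhs_nbhs (conj oW Wa)).
by exists c; split=> //; exact: WB.
Qed.

Section SubshiftWindows.
Variables (M : nzSemiRingType) (Sigma : finType) (Y : subshift M Sigma).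
Implicit Types (x y : Y) (F : seq M).

Lemma config_compact : compact [set: config M Sigma].
Proof.
have cS : compact [set: discrete_topology Sigma].
  by apply: finite_compact; exact: (@finite_finset Sigma).
have := @tychonoff M (fun=> discrete_topology Sigma) (fun=> setT) (fun=> cS).
by congr compact; rewrite eqEsubset; split.
Qed.

Lemma subshift_compact : compact [set: Y].
Proof.
apply: compact_set_type; apply: subclosed_compact config_compact _ => //.
exact: subshift_closed.
Qed.

Lemma nbhs_agree y F : nbhs y [set y' : Y | agree F (val y) (val y')].
Proof.
elim: F => [|i F IH]; first by apply: (filterS (P := setT)) filterT => y' _ j.
have yi : nbhs y [set y' : Y | val y' i = val y i].
  have ci : {for val y, continuous (fun z : config M Sigma => z i)}.
    exact: (@proj_continuous M (fun=> discrete_topology Sigma) i).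
  have cv : {for y, continuous (set_val : Y -> config M Sigma)}.
    exact: initial_continuous.
  exact: (continuous_comp cv ci (discrete_set1 _)).
apply: filterS2 IH yi => y' /= yF yi j.
by rewrite in_cons => /predU1P[->//|]; exact: yF.
Qed.

Lemma nbhs_window y (U : set Y) : nbhs y U ->
  exists F, forall y', agree F (val y) (val y') -> U y'.
Proof.
move=> yU.
(* Coordinates separate points, so each [z] outside [U] is excluded by one of
   them, and by compactness finitely many coordinates exclude all such [z]. *)
have cK : compact (~` U^°).
  apply: subclosed_compact subshift_compact _ => //.
  by rewrite closedC; exact: open_interior.
have [|F FP] := @compact_window _ M _
    (fun F (z : Y) => ~ agree F (val y) (val z)) cK.
  move=> z Uz; have /existsNP[i yzi] : ~ forall i, val y i = val z i.
    by move=> yz; apply: Uz; have <- : y = z by apply/val_inj/funext.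
  exists [:: i], [set z' : Y | agree [:: i] (val z) (val z')].
  split=> [|G z' iG zz' yz']; first exact: nbhs_agree.
  by apply: yzi; rewrite yz' ?iG ?mem_head// zz' ?mem_head.
exists F => y' yy'; apply: interior_subset.
by apply: contrapT => Uy'; exact: FP Uy' yy'.
Qed.

Lemma locally_constant_window (S : Type) (g : Y -> S) :
  (forall y, nbhs y [set y' | g y' = g y]) ->
  exists F, forall y y', agree F (val y) (val y') -> g y = g y'.
Proof.
move=> lg; have [|F FP] := @compact_window _ M _
    (fun F (y : Y) => forall y', agree F (val y) (val y') -> g y = g y')
    subshift_compact.
  move=> y _; have [F FP] := nbhs_window (lg y).
  exists F, [set y' : Y | agree F (val y) (val y')].
  split=> [|G y1 FG yy1 y2 /(agree_sub FG) y12]; first exact: nbhs_agree.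
  by rewrite (FP _ yy1) (FP _ (agree_trans yy1 y12)).
by exists F => y y'; exact: FP.
Qed.

(** A shift-commuting continuous map is a block code: its value at [m] is
    determined by the argument on [F + m], for some finite set [F]. *)
Lemma block_code (Gamma : finType)
    (f : subshift_mspace Y -> full_shift M Gamma) :
  continuous f -> equivariant f ->
  exists F, forall m y y', (forall d, d \in F -> val y (d + m) = val y' (d + m)) ->
    f y m = f y' m.
Proof.
move=> cf ef; have [|F FP] := @locally_constant_window _ (fun y : Y => f y 0).
  move=> y.
  have c0 : {for f y, continuous (fun z : config M Gamma => z 0)}.
    exact: (@proj_continuous M (fun=> discrete_topology Gamma) 0).
  exact: (continuous_comp (cf y) c0 (discrete_set1 _)).
exists F => m y y' yy'.
have fE z : f z m = f (subshift_act m z) 0.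
  by rewrite -[m in LHS]add0r; exact/esym/(congr1 (fun h => h 0) (ef m z)).
by rewrite !fE; apply: FP => d dF; exact: yy'.
Qed.

End SubshiftWindows.

(** * Covers of a quotient by neighbourhoods of fibres *)

Section FiberNbhd.
Variables (M : nzSemiRingType) (Sigma : finType) (Y : subshift M Sigma).
Variables (X : topologicalType) (p : Y -> X).
Hypotheses (cp : continuous p) (sp : forall x, exists y, p y = x).
Hypothesis (hX : hausdorff_space X).
Implicit Types (x : X) (y : Y) (F I : seq M).

(** The points of [X] whose fibre shows on [I] only words that the fibre of
    [y] shows on [I]. *)
Definition fiber_nbhd I y : set X :=
  [set x | forall y', p y' = x ->
     exists2 y1, p y1 = p y & agree I (val y1) (val y')].

Lemma fiber_nbhd_refl I y : fiber_nbhd I y (p y).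
Proof. by move=> y' <-; exists y'. Qed.

Lemma fiber_nbhd_trans I y y' :
  fiber_nbhd I y (p y') -> fiber_nbhd I y' `<=` fiber_nbhd I y.
Proof.
move=> yy' x y'x z zx; have [z1 /yy'[z2 z2y z21] z1z] := y'x z zx.
by exists z2 => //; exact: agree_trans z1z.
Qed.

(** The complement is the image of the points of [Y] whose word on [I] does not
    occur in the fibre of [y], and these form a compact set. *)
Lemma fiber_nbhd_open I y : open (fiber_nbhd I y).
Proof.
pose K := [set y' : Y | forall y1, p y1 = p y -> ~ agree I (val y1) (val y')].
have oK : open (~` K).
  rewrite openE => y' /existsNP[y1 /not_implyP[y1y /contrapT y1y']].
  apply: filterS (nbhs_agree y' I) => z y'z /(_ y1 y1y).
  by apply; exact: agree_trans y'z.
have cK : compact K.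
  apply: subclosed_compact (@subshift_compact _ _ Y) _ => //.
  by rewrite -openC.
rewrite -[fiber_nbhd I y]setCK openC.
rewrite (_ : ~` _ = p @` K); last first.
  rewrite eqEsubset; split=> [x /existsNP[y' /not_implyP[y'x nx]]|_ [y' Ky' <-]].
    by exists y' => // y1 y1y y1y'; apply: nx; exists y1.
  by move=> /(_ y' erefl)[y1 y1y]; exact: Ky'.
apply: compact_closed => //; apply: continuous_compact cK.
exact: continuous_subspaceT.
Qed.

Lemma fiber_nbhd_sub F I y : {subset F <= I} ->
  forall y', fiber_nbhd I y (p y') -> fiber_nbhd F y (p y').
Proof.
move=> FI y' yy' z zy'; have [y1 y1y y1z] := yy' z zy'.
by exists y1 => //; exact: agree_sub y1z.
Qed.

(** The sets [fiber_nbhd I y], for [I] large, are a basis at [p y]. *)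
Lemma fiber_nbhd_basis y (V : set X) : open V -> V (p y) ->
  exists F, fiber_nbhd F y `<=` V.
Proof.
move=> oV Vy.
have cK : compact [set y' : Y | p y' = p y].
  apply: subclosed_compact (@subshift_compact _ _ Y) _ => //.
  apply: (@preimage_closed _ _ p [set p y]) => //.
  exact/accessible_closed_set1/hausdorff_accessible.
have [|F FP] := @compact_window _ M _
  (fun F (z : Y) => forall z', agree F (val z) (val z') -> V (p z')) cK.
  move=> z zy; have : nbhs z (p @^-1` V).
    by apply: cp; rewrite zy; exact: open_nbhs_nbhs.
  move=> /nbhs_window[F FP]; exists F, [set z' : Y | agree F (val z) (val z')].
  split=> [|G z1 FG zz1 z2 /(agree_sub FG) z12]; first exact: nbhs_agree.
  by apply: FP; exact: agree_trans z12.
exists F => x; have [z <-] := sp x => /(_ z erefl)[y1 y1y y1z].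
exact: FP y1z.
Qed.

Lemma fiber_nbhd_refine (C : set (set X)) : open_cover C ->
  exists F, forall I y, {subset F <= I} ->
    exists2 V, C V & fiber_nbhd I y `<=` V.
Proof.
move=> [oC covC]; have [|F FP] := @compact_window _ M _
  (fun F (y : Y) => forall I, {subset F <= I} -> exists2 V, C V & fiber_nbhd I y `<=` V)
  (@subshift_compact _ _ Y).
  move=> y _; have [V CV Vy] : (\bigcup_(U in C) U) (p y) by rewrite covC.
  have [F FV] := fiber_nbhd_basis (oC V CV) Vy.
  exists F, (p @^-1` (fiber_nbhd F y)); split.
    apply: cp; apply: open_nbhs_nbhs; split; first exact: fiber_nbhd_open.
    exact: fiber_nbhd_refl.
  move=> G y1 FG /= yy1 I GI; exists V => //; apply: subset_trans FV.
  apply: subset_trans (fiber_nbhd_trans yy1) => x.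
  have [z <-] := sp x; apply: fiber_nbhd_sub.
  by move=> i /FG; exact: GI.
by exists F => I y; exact: FP.
Qed.

(** If, for arbitrarily large windows [I], the words of a fibre on [I] are
    determined by the word of one of its points on [I] and by a state in a fixed
    finite set, then the dimension of [X] is at most the number of states. *)
Lemma finite_state_dim (P : finType) :
  (forall F, exists2 I, {subset F <= I} &
     exists t : Y -> P, forall y1 y2 y,
       agree I (val y1) (val y2) -> t y1 = t y2 -> p y = p y1 ->
       exists2 y', p y' = p y2 & agree I (val y') (val y)) ->
  covering_dim_le X #|P|.
Proof.
move=> stP C covC; have [F FC] := fiber_nbhd_refine covC.
have [I FI [t tP]] := stP F.
exists (range (fiber_nbhd I)); split.
- split=> [_ [y _ <-]|]; first exact: fiber_nbhd_open.
  rewrite -subTset => x _; have [y <-] := sp x.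
  by exists (fiber_nbhd I y); [exists y|exact: fiber_nbhd_refl].
- by move=> _ [y _ <-]; exact: FC.
move=> x; have [y0 y0x] := sp x.
have tE y1 y2 : agree I (val y1) (val y2) -> t y1 = t y2 ->
    fiber_nbhd I y1 `<=` fiber_nbhd I y2.
  move=> y12 t12; apply: fiber_nbhd_trans => y yy1.
  exact: tP y12 t12 yy1.
(* A member of the cover containing [x] is [fiber_nbhd I y1] for some [y1] that
   agrees with [y0] on [I], and the state of [y1] determines it. *)
pose g (s : P) : set X :=
  \bigcup_(y in [set y | agree I (val y0) (val y) /\ t y = s]) fiber_nbhd I y.
apply: (@card_le_trans _ _ _ [set: P]); last first.
  apply: (card_le_trans (B := [set: 'I_#|P|])).
    apply: card_le_trans (card_image_le enum_val _).
    by apply: subset_card_le => s _; exists (enum_rank s); rewrite ?enum_rankK.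
  by rewrite -(card_le_eql card_II) card_le_II.
apply: card_le_trans (card_image_le g _).
apply: subset_card_le => _ [[y _ <-] yx].
have [y1 y1y y10] := yx y0 y0x.
exists (t y1) => //; rewrite eqEsubset; split=> z.
  move=> [y2 [y02 t21] y2z].
  have yE : fiber_nbhd I y1 `<=` fiber_nbhd I y.
    by apply: fiber_nbhd_trans => w wy1; exists w; rewrite // wy1.
  apply: yE; apply: tE t21 _ y2z.
  exact/agree_sym/(agree_trans y10).
move=> yz; exists y1; first by split=> //; exact: agree_sym.
apply: (@fiber_nbhd_trans I y1 y) yz => w wy; exists w => //.
by rewrite wy.
Qed.

End FiberNbhd.

(** * Gluing across the boundary of a window *)

(** [B] contains the points of [I] that share a translate of [D] with the
    complement of [I]. *)
Definition boundary (M : nzSemiRingType) (D I B : seq M) : Prop :=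
  forall m, (forall d, d \in D -> d + m \in I) \/
            (forall d, d \in D -> d + m \in I -> d + m \in B).

(** Every finite [F] lies in a window whose boundary layer with respect to [D]
    has at most [K] points, where [K] depends on [D] but not on [F]. *)
Definition bounded_boundary (M : nzSemiRingType) : Prop :=
  forall D : seq M, exists K : nat, forall F : seq M, exists I B : seq M,
    [/\ {subset F <= I}, (size B <= K)%N & boundary D I B].

Lemma boundary_sub (M : nzSemiRingType) (D D' I B : seq M) :
  {subset D <= D'} -> boundary D' I B -> boundary D I B.
Proof.
by move=> DD' bI m; case: (bI m) => h; [left|right] => d /DD'; exact: h.
Qed.

(** The configuration equal to [x] on [I] and to [x'] elsewhere. *)
Definition glue (M : eqType) (S : Type) (I : seq M) (x x' : M -> S) : M -> S :=
  fun k => if k \in I then x k else x' k.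

Lemma glue_boundary (M : nzSemiRingType) (S : Type) (D I B : seq M)
    (x x' : M -> S) (m : M) :
  agree B x x' -> (forall d, d \in D -> d + m \in I -> d + m \in B) ->
  forall d, d \in D -> glue I x x' (d + m) = x' (d + m).
Proof.
by move=> xx' mB d dD; rewrite /glue; case: ifPn => // dI; rewrite xx' ?mB.
Qed.

Lemma glue_interior (M : nzSemiRingType) (S : Type) (D I : seq M)
    (x x' : M -> S) (m : M) :
  (forall d, d \in D -> d + m \in I) ->
  forall d, d \in D -> glue I x x' (d + m) = x (d + m).
Proof. by move=> mI d dD; rewrite /glue mI. Qed.

(** For [D] containing the positions of all forbidden words, an occurrence of
    such a word in the glued configuration is an occurrence at the same place in
    [x] or in [x']. *)
Lemma sft_glue (M : nzSemiRingType) (Gamma : finType) (X : subshift M Gamma) :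
  is_sft X -> exists D : seq M, forall I B, boundary D I B ->
  forall x x' : config M Gamma, subshift_set X x -> subshift_set X x' ->
    agree B x x' -> subshift_set X (glue I x x').
Proof.
move=> [W XE]; exists [seq i%:R | i <- iota 0 (\max_(w <- W) size w)].
move=> I B bI x x' Xx Xx' xx'.
move: Xx Xx'; rewrite XE /= => Xx Xx' w wW.
have inD i : (i < size w)%N -> i%:R \in
    [seq i%:R : M | i <- iota 0 (\max_(w <- W) size w)].
  move=> iw; apply: map_f; rewrite mem_iota /= add0n.
  by apply: leq_trans iw _; exact: leq_bigmax_seq.
move=> [m mw].
have eqw (z : config M Gamma) :
    (forall i, (i < size w)%N -> glue I x x' (i%:R + m) = z (i%:R + m)) ->
    occurs w z.
  move=> gz; exists m; rewrite -[RHS]mw; apply/eq_in_map => i.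
  by rewrite mem_iota add0n => /= iw; rewrite addrC gz.
have [mI|mB] := bI m.
  by apply: (Xx w wW); apply: eqw => i /inD iD; exact: (glue_interior _ _ mI).
by apply: (Xx' w wW); apply: eqw => i /inD iD; exact: (glue_boundary xx' mB).
Qed.

(** * The fibres of a sofic relation *)

Section SoficFibers.
Variables (M : nzSemiRingType) (Sigma Gamma1 Gamma2 : finType).
Variables (X1 : subshift M Gamma1) (X2 : subshift M Gamma2).
Variables (f1 : subshift_mspace X1 -> full_shift M (Sigma * Sigma)%type)
          (f2 : subshift_mspace X2 -> full_shift M Sigma).
Hypotheses (sft1 : is_sft X1) (cf1 : continuous f1) (ef1 : equivariant f1).
Hypotheses (sft2 : is_sft X2) (cf2 : continuous f2) (ef2 : equivariant f2).

(** The pair [(z, v)] certifies that [f2 v] is related to [y].  For the block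
    codes of a sofic presentation, the points [f2 v] of the solutions over [y]
    form the fibre of [y]. *)
Definition solution (y : config M Sigma) (z : X1) (v : X2) : Prop :=
  f1 z = pair_config y (f2 v).

(** One window [D] large enough for both subshifts and both block codes.  It
    contains [0], so that the points of [I] outside [B] have their whole
    translate of [D] inside [I]. *)
Lemma solution_glue : exists D : seq M, forall I B, boundary D I B ->
  forall (y y' : config M Sigma) z v z' v',
    solution y z v -> solution y' z' v' -> agree I y y' ->
    agree B (val z) (val z') -> agree B (val v) (val v') ->
    agree B (f2 v) (f2 v') ->
  exists z'' v'', solution y' z'' v'' /\ agree I (f2 v'') (f2 v).
Proof.
have [D1 glue1] := sft_glue sft1; have [D2 glue2] := sft_glue sft2.
have [E1 code1] := block_code cf1 ef1; have [E2 code2] := block_code cf2 ef2.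
exists (0 :: D1 ++ D2 ++ E1 ++ E2) => I B bI y y' z v z' v' sol sol' yy' zz' vv' ww'.
set D := _ :: _ in bI.
have D0 : 0 \in D by rewrite mem_head.
have sD1 : {subset D1 <= D} by move=> i h; rewrite !(inE, mem_cat) h ?orbT.
have sD2 : {subset D2 <= D} by move=> i h; rewrite !(inE, mem_cat) h ?orbT.
have sE1 : {subset E1 <= D} by move=> i h; rewrite !(inE, mem_cat) h ?orbT.
have sE2 : {subset E2 <= D} by move=> i h; rewrite !(inE, mem_cat) h ?orbT.
have X1z := glue1 I B (boundary_sub sD1 bI) _ _
  (set_mem (valP z)) (set_mem (valP z')) zz'.
have X2v := glue2 I B (boundary_sub sD2 bI) _ _
  (set_mem (valP v)) (set_mem (valP v')) vv'.
pose z'' : X1 := exist (fun x => x \in subshift_set X1) _ (mem_set X1z).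
pose v'' : X2 := exist (fun x => x \in subshift_set X2) _ (mem_set X2v).
have int1 m : (forall d, d \in D -> d + m \in I) -> f1 z'' m = f1 z m.
  by move=> mI; apply: code1 => d /sE1 dD; rewrite /= (glue_interior _ _ mI).
have int2 m : (forall d, d \in D -> d + m \in I) -> f2 v'' m = f2 v m.
  by move=> mI; apply: code2 => d /sE2 dD; rewrite /= (glue_interior _ _ mI).
have ext1 m : (forall d, d \in D -> d + m \in I -> d + m \in B) ->
    f1 z'' m = f1 z' m.
  by move=> mB; apply: code1 => d /sE1 dD; rewrite /= (glue_boundary _ mB).
have ext2 m : (forall d, d \in D -> d + m \in I -> d + m \in B) ->
    f2 v'' m = f2 v' m.
  by move=> mB; apply: code2 => d /sE2 dD; rewrite /= (glue_boundary _ mB).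
exists z'', v''; split.
  apply: funext => m; rewrite /pair_config; case: (bI m) => h.
    by rewrite int1// int2// sol /pair_config yy'// -[m]add0r h.
  by rewrite ext1// ext2// sol'.
move=> m mI; case: (bI m) => h; first by rewrite int2.
by rewrite ext2// ww'//; have := h 0 D0; rewrite add0r; exact.
Qed.

(** The state of [y] is the set of patterns on the boundary layer that are
    exhibited by the solutions over [y].  The layer is enumerated with
    repetitions of the default position [0], so that patterns are indexed by
    ['I_K] whatever its size. *)
Lemma sofic_fiber_finite_state : bounded_boundary M ->
  exists P : finType, forall F : seq M, exists2 I, {subset F <= I} &
    exists t : config M Sigma -> P, forall (y y' : config M Sigma) z v,
      agree I y y' -> t y = t y' -> solution y z v ->
      exists z' v', solution y' z' v' /\ agree I (f2 v') (f2 v).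
Proof.
move=> bM; have [D glueD] := solution_glue; have [K KP] := bM D.
exists {set {ffun 'I_K -> Gamma1 * Gamma2 * Sigma}} => F.
have [I [B [FI BK bI]]] := KP F; exists I => //.
pose pat (z : X1) (v : X2) : {ffun 'I_K -> Gamma1 * Gamma2 * Sigma} :=
  [ffun i : 'I_K => (val z B`_i, val v B`_i, f2 v B`_i)].
exists (fun y => [set e | `[< exists z v, solution y z v /\ pat z v = e >]]%SET).
move=> y y' z v yy' /setP/(_ (pat z v)); rewrite !inE => tE sol.
have : `[< exists z0 v0, solution y z0 v0 /\ pat z0 v0 = pat z v >].
  by apply/asboolP; exists z, v.
rewrite tE => /asboolP[z' [v' [sol' /ffunP patE]]].
have BE b : b \in B -> [/\ val z b = val z' b, val v b = val v' b & f2 v b = f2 v' b].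
  move=> bB; have bK : (index b B < K)%N.
    by apply: leq_trans BK; rewrite index_mem.
  by have := patE (Ordinal bK); rewrite !ffunE /= nth_index// => -[-> -> ->].
by apply: (glueD I B bI y y' z v z' v') => // b /BE[].
Qed.

End SoficFibers.

(** * Windows in the natural numbers and in the integers *)

Lemma nat_bounded_boundary : bounded_boundary nat.
Proof.
move=> D; pose L := \max_(d <- D) d; exists L => F.
pose n := (L + \max_(k <- F) k.+1)%N.
exists (iota 0 n), (iota (n - L) L); split; last 1 first.
- move=> m.
  have dL (d : nat) : d \in D -> (d <= L)%N by move=> dD; exact: leq_bigmax_seq.
  have [mL|mL] := leqP n (m + L); [right|left] => d /dL dD.
    by rewrite !mem_iota /GRing.add /=; lia.
  by rewrite !mem_iota /GRing.add /=; lia.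
- move=> k kF; have kn : (k.+1 <= \max_(k <- F) k.+1)%N by exact: leq_bigmax_seq.
  by rewrite mem_iota; lia.
by rewrite size_iota.
Qed.

(** The [n] consecutive integers starting at [a]. *)
Definition int_interval (a : int) (n : nat) : seq int :=
  [seq a + i%:Z | i <- iota 0 n].

Lemma mem_int_interval (a : int) (n : nat) (k : int) :
  (k \in int_interval a n) = (a <= k < a + n%:Z)%R.
Proof.
apply/mapP/idP => [[i]|akn]; first by rewrite mem_iota => ? ->; lia.
by exists `|k - a|%N; [rewrite mem_iota|]; lia.
Qed.

Lemma int_bounded_boundary : bounded_boundary int.
Proof.
move=> D; pose L := \max_(d <- D) `|d|%N; exists (L.*2 + L.*2)%N => F.
pose n := (L.*2 + \max_(k <- F) `|k|.+1)%N.
exists (int_interval (- n%:Z) n.*2),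
  (int_interval (- n%:Z) L.*2 ++ int_interval (n%:Z - L.*2%:Z) L.*2); split.
- move=> k kF; have kn : (`|k|.+1 <= \max_(k <- F) `|k|.+1)%N.
    exact: (@leq_bigmax_seq _ F predT (fun k : int => `|k|.+1)).
  by rewrite mem_int_interval; lia.
- by rewrite size_cat !size_map !size_iota.
move=> m.
have dL (d : int) : d \in D -> (`|d| <= L)%N.
  by move=> dD; exact: (@leq_bigmax_seq _ D predT (fun k : int => `|k|%N)).
have [mL|mL] := boolP ((- n%:Z + L%:Z <= m) && (m + L%:Z < n%:Z))%R;
    [left|right] => d /dL dD.
  by rewrite mem_int_interval; lia.
by rewrite mem_cat !mem_int_interval; lia.
Qed.

(** * Finite dimension *)

Lemma sofically_presented_finite_dim (M : nzSemiRingType) (X : mspace M) :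
  bounded_boundary M -> hausdorff_space X -> sofically_presented X ->
  finite_covering_dim X.
Proof.
move=> bM hX [Sigma [Y [Z [ZY [soficY soficZ]]]]].
move=> [f [_ [g [cg fK gK]]] _].
pose p (y : Y) : X := g (quot_class ZY y).
have cp : continuous p.
  move=> y; apply: continuous_comp; last exact: cg.
  exact: (@pi_continuous _ {eq_quot (pair_equiv ZY)}).
have sp x : exists y, p y = x.
  by have [y fx] := quot_class_surj (f x); exists y; rewrite /p -fx fK.
have pP y y' : p y = p y' <-> subshift_set Z (pair_config (val y) (val y')).
  by rewrite -(quot_classP ZY) /p; split=> [|->//]; exact: (can_inj gK).
have [Gamma1 [X1 [f1 [sft1 cf1 ef1 Z1]]]] := soficZ.
have [Gamma2 [X2 [f2 [sft2 cf2 ef2 Y2]]]] := soficY.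
have [P PP] := sofic_fiber_finite_state sft1 cf1 ef1 sft2 cf2 ef2 bM.
have pS y w : p w = p y <-> exists z v, solution f1 f2 (val y) z v /\ f2 v = val w.
  split=> [/esym/pP|[z [v [sol vw]]]].
    rewrite Z1 => -[z _ zE].
    have [v _ vw] : range f2 (val w) by rewrite -Y2; exact/set_mem/valP.
    by exists z, v; rewrite /solution vw.
  by apply/esym/pP; rewrite Z1 -vw; exists z.
exists #|P|; apply: (finite_state_dim cp sp hX) => F.
have [I FI [t tP]] := PP F; exists I => //.
exists (fun y => t (val y)) => y1 y2 w y12 t12 /pS[z [v [sol vw]]].
have [z' [v' [sol' v'v]]] := tP _ _ _ _ y12 t12 sol.
have Yv' : subshift_set Y (f2 v') by rewrite Y2; exists v'.
(* The range of [f2] is [Y], so the point [f2 v'] lies in [Y]. *)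
exists (exist (fun x => x \in subshift_set Y) _ (mem_set Yv')).
  by apply/pS; exists z', v'.
by rewrite -vw.
Qed.

Lemma metrizable_hausdorff (R : realType) (T : topologicalType) :
  metrizable R T -> hausdorff_space T.
Proof.
move=> [W [f [cf [g [_ fK _]]]]] x y xy; apply: (can_inj fK).
apply: metric_hausdorff => A B fxA fyB.
by have [z [Az Bz]] := xy _ _ (cf x _ fxA) (cf y _ fyB); exists (f z).
Qed.

Theorem theorem1p7 (R : realType) (M : nzSemiRingType)
    (hM : M = nat :> nzSemiRingType \/ M = int :> nzSemiRingType)
    (X : mspace M) (hX : dynamical_system R X)
    (hsofic : sofically_presented X) :
  finite_covering_dim X.
Proof.
apply: sofically_presented_finite_dim hsofic.
  by case: hM => ->; [exact: nat_bounded_boundary|exact: int_bounded_boundary].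
by case: hX => _; exact: metrizable_hausdorff.
Qed.
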